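(* Assume that $E\subseteq\mathbb{R}$ is a $G_\delta$ set and that $E$ has uniform density type (UDT). Then there exists a continuous function $f:\mathbb{R}\to\mathbb{R}$ satisfying $\operatorname{Lip} f=\mathbf{1}_E$ on $\mathbb{R}$; that is, the set $E$ is $\operatorname{Lip}1$.
   Context: For a continuous $f:\mathbb{R}\to\mathbb{R}$, $x\in\mathbb{R}$ and $r>0$ put $M_f(x,r)=\frac{1}{r}\sup\{|f(x)-f(y)|:|x-y|\le r\}$ and $\operatorname{Lip} f(x)=\limsup_{r\to0^+}M_f(x,r)$. $\mathbf{1}_E$ is the characteristic function of $E$, and $|A|$ denotes the Lebesgue measure of $A$. A set $E\subseteq\mathbb{R}$ is $\operatorname{Lip}1$ if there is a continuous $f:\mathbb{R}\to\mathbb{R}$ with $\operatorname{Lip} f=\mathbf{1}_E$. For a measurable $E\subseteq\mathbb{R}$ and $\gamma,\delta>0$ let $$E^{\gamma,\delta}=\left\{x\in\mathbb{R}:\ \forall r\in(0,\delta],\ \max\left\{\frac{|(x-r,x)\cap E|}{r},\frac{|(x,x+r)\cap E|}{r}\right\}\ge\gamma\right\}.$$ A measurable set $E$ has uniform density type (UDT) if there exist sequences of positive numbers $\gamma_n\nearrow1$ (increasing to $1$) and $\delta_n\searrow0$ (decreasing to $0$) such that $E\subseteq\bigcap_{k=1}^\infty\bigcup_{n=k}^\infty E^{\gamma_n,\delta_n}$. *)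

(* Defs.v *)
From mathcomp Require Import all_boot all_order all_algebra.
From mathcomp Require Import all_classical all_reals all_analysis.
Import Order.TTheory GRing.Theory Num.Theory.
Import numFieldNormedType.Exports.

Set Implicit Arguments.
Unset Strict Implicit.
Unset Printing Implicit Defensive.

Local Open Scope classical_set_scope.
Local Open Scope ring_scope.

Section LipOne.
Context {R : realType}.

(* Values are in [\bar R]: the limsup defining [Lip f x] may be [+oo]. *)
Definition oscillation_quotient (f : R -> R) (x r : R) : \bar R :=
  (ereal_sup [set `|f x - f y|%R%:E | y in [set y : R | `|x - y| <= r]%R] / r%:E)%E.

Definition Lip (f : R -> R) (x : R) : \bar R :=
  limf_esup (oscillation_quotient f x) 0^'+.

Definition is_Lip1 (E : set R) : Prop :=
  exists2 f : R -> R, continuous f & forall x, Lip f x = (\1_E x)%:E.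

(* Caratheodory measurability for the outer measure generated by the length
   of intervals; [measurable] on [R] would mean Borel. *)
Definition Lebesgue_measurable (E : set R) : Prop :=
  ((wlength idfun)^*)%mu.-cara.-measurable E.

Definition one_sided_density_set (E : set R) (gamma delta : R) : set R :=
  [set x | forall r : R, r \in `]0, delta] ->
    (gamma%:E <= maxe (lebesgue_measure (`](x - r)%R, x[ `&` E) / r%:E)
                      (lebesgue_measure (`]x, (x + r)%R[ `&` E) / r%:E))%E].

(* The sequences are monotone in the weak sense; scaling [gamma_ n] by
   [1 - 1 / (n + 2)] and [delta_ n] by [(1 + 1 / (n + 1)) / 2] makes them
   strictly monotone and only enlarges the sets, so the strict reading defines
   the same class of sets. *)
Definition uniform_density_type (E : set R) : Prop :=
  Lebesgue_measurable E /\
  exists gamma_ delta_ : R^nat,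
    [/\ forall n, 0 < gamma_ n, nondecreasing_seq gamma_
      & gamma_ n @[n --> \oo] --> (1 : R)] /\
    [/\ forall n, 0 < delta_ n, nonincreasing_seq delta_
      & delta_ n @[n --> \oo] --> (0 : R)] /\
    E `<=` \bigcap_k \bigcup_(n >= k)
             one_sided_density_set E (gamma_ n) (delta_ n).

End LipOne.

(* Main.v *)
Require Import Defs.
From mathcomp Require Import all_boot all_order all_algebra.
From mathcomp Require Import all_classical all_reals all_analysis borel_hierarchy.
From mathcomp Require Import measurable_realfun zify ring lra.
Import Order.TTheory GRing.Theory Num.Theory.
Import numFieldNormedType.Exports.

Set Implicit Arguments.
Unset Strict Implicit.
Unset Printing Implicit Defensive.

Local Open Scope classical_set_scope.
Local Open Scope ring_scope.

(* Let [F n] be closed sets increasing to the complement of [E]. The function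
   is [f = \sum_n wave n], where [wave n] is a zigzag of slopes [1] and [-1]
   with respect to the measure [A |-> |L n `&` A|]; the disjoint layers [L n]
   cover [E] up to the points lying in infinitely many of the sets [cover m].
   Hence [f] is 1-Lipschitz.

   [cover n] is a neighbourhood of [F n `\` F n.-1], and [L n] is the part of
   [E `&` cover n] that lies in no later cover. Near a point [x] first captured
   by [F n], the layers before [n] are absent and the later zigzags vanish on
   [F n] and are quadratically small around it, so that [Lip f x = 0].

   Zeros of the zigzags and ends of the covers are dyadic points of [grid]s that
   are locally finite off [F n]. So around [x] in [E] and for each [n] there is
   an interval with at most one grid point of level at most [n]; on each side of
   it [f] is, up to the tiny measure of the later covers, a single zigzag with
   at most one kink. Among four widely separated scales [r] one avoids the grid
   point and both kinks, and there the increments of [f] over [[x - r, x]] and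
   [[x, x + r]] are about [|E `&` [x - r, x]|] and [|E `&` [x, x + r]|]. Uniform
   density type makes one of these close to [r], whence [Lip f x = 1]. *)

(** * Lebesgue measure of a set inside a bounded interval *)

Section Mass.
Context {R : realType}.
Implicit Types (A B C : set (measurableTypeR R)) (a b c : R).

Definition mass A a b : R := fine (lebesgue_measure (A `&` `]a, b])).

Lemma massE A a b : measurable A ->
  (mass A a b)%:E = lebesgue_measure (A `&` `]a, b]).
Proof.
move=> mA; rewrite /mass fineK// ge0_fin_numE//.
have mi : measurable (`]a, b]%classic : set (measurableTypeR R)) by [].
apply: (@le_lt_trans _ _ (lebesgue_measure (`]a, b]%classic : set (measurableTypeR R)))).
  by apply: le_measure; rewrite ?inE//; exact: measurableI.
by rewrite lebesgue_measure_itv/=; case: ifP; rewrite ?ltry.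
Qed.

Lemma mass_ge0 A a b : 0 <= mass A a b.
Proof. by rewrite /mass fine_ge0. Qed.

Lemma le_mass A B a b : measurable A -> measurable B ->
  (forall x, a < x <= b -> A x -> B x) -> mass A a b <= mass B a b.
Proof.
move=> mA mB AB; rewrite -lee_fin !massE//.
apply: le_measure; rewrite ?inE; try exact: measurableI.
by move=> x [Ax]; rewrite /= in_itv/= => xab; split; first exact: AB.
Qed.

Lemma mass_set0 a b : mass set0 a b = 0.
Proof. by rewrite /mass set0I measure0. Qed.

Lemma mass_eq0 A a b : measurable A ->
  (forall x, a < x <= b -> ~ A x) -> mass A a b = 0.
Proof.
move=> mA A0; apply/eqP; rewrite eq_le mass_ge0 andbT -(mass_set0 a b).
by apply: le_mass => // x /A0.
Qed.

Lemma mass_le_length A a b : measurable A -> a <= b -> mass A a b <= b - a.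
Proof.
move=> mA ab; rewrite -lee_fin massE//.
apply: (@le_trans _ _ (lebesgue_measure (`]a, b]%classic : set (measurableTypeR R)))).
  by apply: le_measure; rewrite ?inE//; exact: measurableI.
rewrite lebesgue_measure_itv/= lte_fin; case: ifP => //.
by rewrite lee_fin subr_ge0.
Qed.

Lemma mass_split A a b c : measurable A -> a <= b -> b <= c ->
  mass A a c = mass A a b + mass A b c.
Proof.
move=> mA ab bc; apply: EFin_inj; rewrite EFinD !massE//.
rewrite -measureU; try exact: measurableI.
  rewrite -setIUr; congr (lebesgue_measure (_ `&` _)).
  apply/seteqP; split => x /=; rewrite !in_itv/=.
    by move=> /andP[-> ->]/=; rewrite andbT; case: (leP x b); [left|right].
  case=> /andP[ax xb]; apply/andP; split => //.
  - exact: le_trans bc.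
  - exact: le_lt_trans ax.
apply/seteqP; split => x //= [[_ +] [_ +]]; rewrite !in_itv/= => /andP[_ xb] /andP[bx _].
by move: (lt_le_trans bx xb); rewrite ltxx.
Qed.

Lemma mass_leD A B C a b : measurable A -> measurable B -> measurable C ->
  (forall x, a < x <= b -> A x -> B x \/ C x) ->
  mass A a b <= mass B a b + mass C a b.
Proof.
move=> mA mB mC ABC; rewrite -lee_fin EFinD !massE//.
have mi : measurable (`]a, b]%classic : set (measurableTypeR R)) by [].
apply: le_trans (measureU2 _ _ _); try exact: measurableI.
apply: le_measure; rewrite ?inE; try exact: measurableI.
  by apply: measurableU; exact: measurableI.
move=> x [Ax]; rewrite /= in_itv/= => xab.
by case: (ABC _ xab Ax) => ?; [left|right]; split=> //=; rewrite in_itv.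
Qed.

Lemma sum_mass_le (E_ : nat -> set (measurableTypeR R)) B a b (P : pred nat) n :
  (forall j, measurable (E_ j)) -> measurable B -> trivIset setT E_ ->
  (forall j x, P j -> a < x <= b -> E_ j x -> B x) ->
  \sum_(j < n | P j) mass (E_ j) a b <= mass B a b.
Proof.
move=> mE mB tE EB.
pose D j := (if P j then E_ j else set0) `&` `]a, b].
have mD j : measurable (D j).
  by apply: measurableI => //; case: ifP.
have -> : \sum_(j < n | P j) mass (E_ j) a b = \sum_(j < n) fine (lebesgue_measure (D j)).
  rewrite big_mkcond; apply: eq_bigr => j _; rewrite /D; case: ifP => // _.
  by rewrite set0I measure0.
have Dfin j : lebesgue_measure (D j) = (fine (lebesgue_measure (D j)))%:E.
  by rewrite /D; case: ifP => _; rewrite -?(massE _ _ (mE j))// set0I measure0.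
rewrite -lee_fin massE// -sumEFin; under eq_bigr do rewrite -Dfin.
rewrite -measure_bigsetU//.
  apply: le_measure; rewrite ?inE.
  - by apply: bigsetU_measurable.
  - exact: measurableI.
  rewrite -bigcup_mkord => x [j _] [].
  case: ifP => // Pj Ejx; rewrite /= in_itv/= => xab; by split=> //; exact: (EB j).
move/trivIsetP : tE => tE; apply/trivIsetP => i j _ _ ij.
apply/seteqP; split => x //= [[+ _] [+ _]].
case: ifP => // _ Ei; case: ifP => // _ Ej.
by have := tE i j I I ij; move/seteqP => [/(_ x) + _]; apply.
Qed.

(** One of the two terms is always zero. For measurable [A] this is the primitive of the indicator
    of [A] that vanishes at [0]. *)
Definition cumul A y : R := mass A 0 y - mass A y 0.

Lemma mass_nil A a b : b <= a -> mass A a b = 0.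
Proof.
move=> ba; rewrite /mass; suff -> : `]a, b]%classic = set0 by rewrite setI0 measure0.
apply/seteqP; split => x //=; rewrite in_itv/= => /andP[ax xb].
by move: (lt_le_trans ax (le_trans xb ba)); rewrite ltxx.
Qed.

Lemma cumulB A a b : measurable A -> a <= b -> cumul A b - cumul A a = mass A a b.
Proof.
move=> mA ab; rewrite /cumul; have [a0|a0] := leP 0 a.
  have b0 := le_trans a0 ab.
  by rewrite (mass_split mA a0 ab) (mass_nil _ a0) (mass_nil _ b0); ring.
have [b0|b0] := leP 0 b.
  by rewrite (mass_split mA (ltW a0) b0) (mass_nil _ b0) (mass_nil _ (ltW a0)); ring.
by rewrite (mass_split mA ab (ltW b0)) (mass_nil _ (ltW b0)) (mass_nil _ (ltW a0)); ring.
Qed.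

Lemma cumul_le A a b : measurable A -> a <= b -> cumul A a <= cumul A b.
Proof. by move=> mA ab; rewrite -subr_ge0 cumulB// mass_ge0. Qed.

Lemma dist_cumul A a b : measurable A -> a <= b ->
  `|cumul A b - cumul A a| = mass A a b.
Proof. by move=> mA ab; rewrite cumulB// ger0_norm// mass_ge0. Qed.

Lemma cumul_lip A a b : measurable A -> `|cumul A a - cumul A b| <= `|a - b|.
Proof.
move=> mA; wlog ab : a b / a <= b.
  by move=> H; have [/H//|/ltW/H] := leP a b; rewrite distrC (distrC b).
by rewrite distrC (distrC a) dist_cumul// ger0_norm ?subr_ge0// mass_le_length.
Qed.

End Mass.

(** * Infima of nonnegative 1-Lipschitz functions *)

Section InfimumOfLipschitz.
Context {R : realType} {I : Type}.
Context (P : set I) (h : I -> R -> R) (P0 : P !=set0).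
Context (h_ge0 : forall i x, 0 <= h i x).

Let infh x := inf [set h i x | i in P].

Lemma infh_le i x : P i -> infh x <= h i x.
Proof.
move=> Pi; apply: ge_inf; last by exists i.
by exists 0 => _ [j _ <-].
Qed.

Lemma le_infh x c : (forall i, P i -> c <= h i x) -> c <= infh x.
Proof.
move=> H; apply: lb_le_inf; first by case: P0 => i Pi; exists (h i x), i.
by move=> _ [j Pj <-]; exact: H.
Qed.

Lemma infh_lip x y : (forall i x y, h i x <= h i y + `|x - y|) ->
  `|infh x - infh y| <= `|x - y|.
Proof.
move=> hL; have H u v : infh u - infh v <= `|u - v|.
  rewrite lerBlDl -lerBlDr; apply: le_infh => i Pi.
  rewrite lerBlDr; apply: le_trans (hL i u v); exact: infh_le.
by rewrite ler_norml H lerNl opprB distrC H.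
Qed.

End InfimumOfLipschitz.

(** * The distance to a set and its shape in a gap *)

Section DistanceToSet.
Context {R : realType}.
Implicit Types (S : set R) (s t : R).

Definition dist_set S t : R := inf [set `|t - s| | s in S].

Lemma dist_set_ge0 S t : S !=set0 -> 0 <= dist_set S t.
Proof. by move=> S0; apply: (le_infh (h := fun s t => `|t - s|)). Qed.

Lemma dist_set_le S s t : S s -> dist_set S t <= `|t - s|.
Proof. by move=> Ss; apply: (infh_le (h := fun s t => `|t - s|)). Qed.

Lemma dist_set_lip S s t : S !=set0 ->
  `|dist_set S s - dist_set S t| <= `|s - t|.
Proof.
move=> S0; apply: (infh_lip (h := fun s t => `|t - s|)) => // i x y.
by have := ler_distD y x i; lra.
Qed.

(** Inside the gap the distance is the minimum of [t - l] and [r - t], where [l] and [r] are the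
    supremum and the infimum of the parts of [S] on either side. The only kink [k] is their
    midpoint. *)
Lemma dist_set_tent S a b : (forall s, S s -> s <= a \/ b <= s) ->
  (exists2 s, S s & s <= a) -> (exists2 s, S s & b <= s) ->
  exists k, forall s t, a <= s -> s <= t -> t <= b ->
    (t <= k -> dist_set S t - dist_set S s = t - s) /\
    (k <= s -> dist_set S s - dist_set S t = t - s).
Proof.
move=> Sab [s1 Ss1 s1a] [s2 Ss2 bs2].
pose l := sup [set s | S s /\ s <= a]; pose r := inf [set s | S s /\ b <= s].
have lub s : S s -> s <= a -> s <= l.
  by move=> Ss sa; apply: ub_le_sup; [exists a => x []|].
have rlb s : S s -> b <= s -> r <= s.
  by move=> Ss sa; apply: ge_inf; [exists b => x []|].
have DE t : a <= t -> t <= b -> dist_set S t = Num.min (t - l) (r - t).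
  move=> at_ tb; apply/eqP; rewrite eq_le le_min; apply/andP; split.
    apply/andP; split.
    - rewrite lerBrDl -lerBrDr; apply: ge_sup; first by exists s1.
      move=> s [Ss sa]; rewrite lerBrDl -lerBrDr.
      by apply: le_trans (dist_set_le t Ss) _; rewrite ger0_norm//; lra.
    - rewrite lerBrDl; apply: lb_le_inf; first by exists s2.
      move=> s [Ss sa]; have := dist_set_le t Ss.
      by rewrite distrC ger0_norm; lra.
  apply: (le_infh (h := fun s t => `|t - s|)); first by exists s1.
  move=> s Ss; rewrite ge_min; case: (Sab _ Ss) => H.
    by have := lub _ Ss H; rewrite ger0_norm; [|lra]; move=> ?; apply/orP; left; lra.
  have := rlb _ Ss H; rewrite distrC ger0_norm; [|lra].
  by move=> ?; apply/orP; right; lra.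
exists ((l + r) / 2) => s t as_ st tb.
rewrite !DE; [|lra..]; split => H.
- by rewrite !min_l; lra.
- by rewrite !min_r; lra.
Qed.

End DistanceToSet.

Lemma lipschitz1_continuous {R : realType} (f : R -> R) :
  (forall x y, `|f x - f y| <= `|x - y|) -> continuous f.
Proof.
move=> fL x; apply/cvgrPdist_le => e e0; near=> y.
apply: le_trans (fL _ _) _; near: y.
by apply: cvgr_dist_le => //; exact: cvg_id.
Unshelve. all: by end_near. Qed.

(** * A bounded, decaying distance to a closed set *)

Section Depth.
Context {R : realType}.
Implicit Types (F : set R) (x y z : R).

(* The term [(1 + |x|)^-1] makes the sets [c <= depth F] bounded, and it keeps
   the infimum meaningful when [F] is empty. *)
Definition depth F x : R :=
  inf [set (if o is Some z then `|x - z| else (1 + `|x|)^-1) |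
       o in [set o | if o is Some z then F z else True]].

Let h (o : option R) x := if o is Some z then `|x - z| else (1 + `|x|)^-1.

Lemma invD_norm_lip x y : (1 + `|x|)^-1 <= (1 + `|y|)^-1 + `|x - y|.
Proof.
have x0 : 0 < 1 + `|x| by rewrite ltr_pwDl.
have y0 : 0 < 1 + `|y| by rewrite ltr_pwDl.
have H : `|y| <= `|x| + `|x - y|.
  by have := ler_distD x y 0; rewrite !subr0 (distrC x); lra.
rewrite -subr_ge0.
(* Over a common denominator the numerator is a sum of nonnegative terms, the first one by the
   triangle inequality. *)
have -> : (1 + `|y|)^-1 + `|x - y| - (1 + `|x|)^-1 =
  ((`|x| - `|y| + `|x - y|) + `|x - y| * (`|x| + `|y| + `|x| * `|y|)) / ((1 + `|x|) * (1 + `|y|)).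
  by field; rewrite !gt_eqF.
rewrite divr_ge0 ?mulr_ge0 ?(ltW x0) ?(ltW y0)// addr_ge0//; lra.
Qed.

Lemma depth_ge0 F x : 0 <= depth F x.
Proof.
apply: (le_infh (h := h)); first by exists None.
by case=> [z|] _ /=; rewrite ?invr_ge0 ?addr_ge0.
Qed.

Let h_ge0 o x : 0 <= h o x.
Proof. by case: o => [z|]; rewrite /h ?invr_ge0 ?addr_ge0. Qed.

Lemma depth_lip F x y : `|depth F x - depth F y| <= `|x - y|.
Proof.
apply: (infh_lip (h := h)) => //; first by exists None.
case=> [z|] u v; last exact: invD_norm_lip.
by rewrite /h; have := ler_distD v u z; lra.
Qed.

Lemma depth_leD F x y : depth F x <= depth F y + `|x - y|.
Proof. by have := depth_lip F x y; rewrite ler_norml => /andP[_]; rewrite lerBlDl. Qed.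

Lemma depth_bound F x : depth F x * (1 + `|x|) <= 1.
Proof.
rewrite -ler_pdivlMr ?ltr_pwDl// div1r.
exact: (@infh_le _ _ [set o | if o is Some z then F z else True] h h_ge0 None).
Qed.

Lemma depth_le1 F x : depth F x <= 1.
Proof.
by apply: le_trans (depth_bound F x); rewrite ler_peMr ?depth_ge0// lerDl.
Qed.

Lemma depth_le_dist F x z : F z -> depth F x <= `|x - z|.
Proof. by move=> Fz; exact: (@infh_le _ _ [set o | if o is Some z then F z else True] h h_ge0 (Some z)). Qed.

Lemma depth_in F x : F x -> depth F x = 0.
Proof.
move=> Fx; apply/eqP; rewrite eq_le depth_ge0 andbT.
by have := depth_le_dist x Fx; rewrite subrr normr0.
Qed.

Lemma depth_gt0 F x : closed F -> ~ F x -> 0 < depth F x.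
Proof.
move=> cF Fx.
have : nbhs x (~` F) by apply: open_nbhs_nbhs; split; [exact: closed_openC|].
move=> /nbhs_ballP[r /= r0 rF].
have H : 0 < (1 + `|x|)^-1 by rewrite invr_gt0 ltr_pwDl.
apply: (@lt_le_trans _ _ (Num.min r (1 + `|x|)^-1)); first by rewrite lt_min r0.
apply: (le_infh (h := h)); first by exists None.
case=> [z|] /= Fz; last by rewrite ge_min lexx orbT.
rewrite ge_min; apply/orP; left; rewrite leNgt; apply/negP => xz.
by apply: (rF z).
Qed.

Lemma depth_anti F F' x : F `<=` F' -> depth F' x <= depth F x.
Proof.
move=> FF'; apply: (le_infh (h := h)); first by exists None.
move=> o Fo; apply: (@infh_le _ _ [set o | if o is Some z then F' z else True] h h_ge0 o).
by case: o Fo => //= z; exact: FF'.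
Qed.

Lemma continuous_depth F : continuous (depth F).
Proof. exact/lipschitz1_continuous/depth_lip. Qed.

End Depth.

(** * Dyadic grids that refine as a Lipschitz function decreases *)

Section Grid.
Context {R : realType}.
Implicit Types (e : R -> R) (N : nat -> nat) (x y k : R).

Lemma exp2V_gt0 n : 0 < 2 ^- n :> R. Proof. by rewrite invr_gt0 exprn_gt0. Qed.

Lemma exp2VS n : 2 ^- n.+1 = 2 ^- n / 2 :> R.
Proof. by rewrite exprS invfM mulrC. Qed.

Lemma ler_exp2V n m : (n <= m)%N -> 2 ^- m <= 2 ^- n :> R.
Proof. by move=> nm; rewrite lef_pV2 ?posrE ?exprn_gt0// ler_eXn2l// ltr1n. Qed.

Lemma ltr_exp2V_leq n m : 2 ^- m < 2 ^- n :> R -> (n < m)%N.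
Proof. by rewrite ltnNge; apply: contraTN => /ler_exp2V; rewrite leNgt. Qed.

Lemma exp2V_small (c : R) : 0 < c -> exists n, 2 ^- n < c.
Proof.
move=> c0.
have : (2 ^- n : R) @[n --> \oo] --> (0 : R).
  under eq_fun do rewrite -exprVn.
  by apply: cvg_expr; rewrite ger0_norm ?invr_ge0// invf_lt1// ltr1n.
move=> /cvgrPdist_lt/(_ _ c0)[n _ /(_ n (leqnn n))]; rewrite sub0r normrN.
by rewrite ger0_norm ?(ltW (exp2V_gt0 _))// => ?; exists n.
Qed.

Lemma exp2V_shell (c : R) : 0 < c -> c <= 1 -> exists i, 2 ^- i.+1 < c <= 2 ^- i.
Proof.
move=> c0 c1; have [n nc] := exp2V_small c0.
have ex : exists m, 2 ^- m < c by exists n.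
case: (ex_minnP ex) => [[|m]]; first by rewrite expr0 invr1 ltNge c1.
by move=> mc H; exists m; rewrite mc leNgt; apply/negP => /H; rewrite ltnn.
Qed.

(* Dyadic points whose admissible denominators [2 ^ N i] grow as the value of
   [e] drops below [2 ^- i]. *)
Definition grid e N : set R :=
  [set k | exists i, k * 2 ^+ N i \is a Num.int /\ e k <= 2 * 2 ^- i].

Lemma grid_sub e e' N N' : (forall x, e' x <= e x) ->
  (forall i, N i <= N' i)%N -> grid e N `<=` grid e' N'.
Proof.
move=> ee NN k [i [ki ek]]; exists i; split; last exact: le_trans ek.
rewrite -(subnKC (NN i)) exprD mulrA rpredM// rpredX//.
exact: natr_int.
Qed.

Section GridLip.
Context (e : R -> R) (N : nat -> nat).
Context (e_lip : forall x y, e x <= e y + `|x - y|).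
Context (N_ge : forall i, (i <= N i)%N).

(** The factor [2] in [grid] pays for the step from [y] to [k], whose length is at most
    [2 ^- N i <= 2 ^- i]. *)
Let in_grid i y k : e y <= 2 ^- i -> `|k - y| <= 2 ^- N i ->
  k * 2 ^+ N i \is a Num.int -> grid e N k.
Proof.
move=> ey ky kint; exists i; split => //.
have := e_lip k y; have := ler_exp2V (N_ge i); lra.
Qed.

Lemma grid_right i y : e y <= 2 ^- i ->
  exists k, [/\ grid e N k, y < k & k <= y + 2 ^- N i].
Proof.
move=> ey; have p0 := exp2V_gt0 (N i); have q0 : 0 < 2 ^+ N i :> R by rewrite exprn_gt0.
have pq : 2 ^- N i * 2 ^+ N i = 1 :> R by rewrite mulVf// gt_eqF.
pose k : R := ((Num.floor (y * 2 ^+ N i))%:~R + 1) / 2 ^+ N i.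
have kq : k * 2 ^+ N i = (Num.floor (y * 2 ^+ N i))%:~R + 1 by rewrite divfK// gt_eqF.
have yk : y < k by rewrite /k ltr_pdivlMr//; have := floorD1_gt (y * 2 ^+ N i); rewrite intrD.
have ky : k <= y + 2 ^- N i.
  by rewrite /k ler_pdivrMr// mulrDl pq lerD2r floor_le.
exists k; split=> //; apply: (@in_grid i y) => //.
  by rewrite gtr0_norm; lra.
by rewrite kq rpredD ?rpred1 ?intr_int.
Qed.

Lemma grid_left i y : e y <= 2 ^- i ->
  exists k, [/\ grid e N k, k < y & y <= k + 2 ^- N i].
Proof.
move=> ey; have p0 := exp2V_gt0 (N i); have q0 : 0 < 2 ^+ N i :> R by rewrite exprn_gt0.
have pq : 2 ^- N i * 2 ^+ N i = 1 :> R by rewrite mulVf// gt_eqF.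
pose k : R := ((Num.ceil (y * 2 ^+ N i))%:~R - 1) / 2 ^+ N i.
have kq : k * 2 ^+ N i = (Num.ceil (y * 2 ^+ N i))%:~R - 1 by rewrite divfK// gt_eqF.
have yk : k < y by rewrite /k ltr_pdivrMr//; have := ceilB1_lt (y * 2 ^+ N i); rewrite intrB.
have ky : y <= k + 2 ^- N i.
  by rewrite -lerBlDr /k ler_pdivlMr// mulrBl pq lerD2r ceil_ge.
exists k; split=> //; apply: (@in_grid i y) => //.
  by rewrite ltr0_norm; lra.
by rewrite kq rpredB ?rpred1 ?intr_int.
Qed.

(** Near [x] the value of [e] stays so large that only levels [j <= i.+2] occur. The grid points
    there are thus integer multiples of [2 ^- N i.+2], and two of them less than that apart
    coincide. *)
Lemma grid_sep i x r : {homo N : a b / (a <= b)%N} -> 2 ^- i.+1 < e x ->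
  r <= 2 ^- (N i.+2).+1 ->
  forall k k', grid e N k -> grid e N k' -> `|x - k| < r -> `|x - k'| < r -> k = k'.
Proof.
move=> Nm ex rN.
have H k : grid e N k -> `|x - k| < r -> k * 2 ^+ N i.+2 \is a Num.int.
  move=> [j [kj ek]] xk.
  have ji : (j <= i.+2)%N.
    rewrite -ltnS; apply: ltr_exp2V_leq.
    have := e_lip x k.
    have : 2 ^- (N i.+2).+1 <= 2 ^- i.+3 :> R by apply: ler_exp2V; rewrite ltnS.
    have := exp2VS i.+3; have := exp2VS i.+2; have := exp2VS i.+1; have := exp2VS j.
    have := exp2V_gt0 i.+1; lra.
  rewrite -(subnKC (Nm _ _ ji)) exprD mulrA rpredM// rpredX//.
  exact: natr_int.
move=> k k' Kk Kk' xk xk'.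
have /intrP[z zE] := H _ Kk xk; have /intrP[z' z'E] := H _ Kk' xk'.
have q0 : 0 < 2 ^+ N i.+2 :> R by rewrite exprn_gt0.
suff zz : z = z'.
  by apply: (mulIf (lt0r_neq0 q0)); rewrite zE z'E zz.
have kk : `|k - k'| < 2 ^- N i.+2.
  have := ler_distD x k k'; rewrite (distrC k x).
  by have := exp2VS (N i.+2); lra.
have : `|(z - z')%:~R| < 1 :> R.
  rewrite intrB -zE -z'E -mulrBl normrM (gtr0_norm q0).
  by rewrite -ltr_pdivlMr// div1r.
by rewrite -intr_norm (_ : 1 = 1%:~R)// ltr_int; lia.
Qed.

End GridLip.
End Grid.

(** * Zigzags with respect to the measure restricted to a set *)

Section Zigzag.
Context {R : realType}.
Implicit Types (A : set (measurableTypeR R)) (K : set R).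

(** The distance is taken in the coordinate [cumul A], so that increments compare with [mass A]
    instead of length. *)
Definition zigzag A K y : R := dist_set (cumul A @` K) (cumul A y).

Lemma zigzag_lip A K a b : measurable A -> K !=set0 -> a <= b ->
  `|zigzag A K b - zigzag A K a| <= mass A a b.
Proof.
move=> mA [k Kk] ab; rewrite -dist_cumul//; apply: dist_set_lip.
by exists (cumul A k), k.
Qed.

Lemma zigzag_ge0 A K y : K !=set0 -> 0 <= zigzag A K y.
Proof. by move=> [k Kk]; apply: dist_set_ge0; exists (cumul A k), k. Qed.

Lemma zigzag_le A K k y : measurable A -> K k -> zigzag A K y <= `|y - k|.
Proof.
move=> mA Kk; apply: le_trans (cumul_lip _ _ mA).
by apply: dist_set_le; exists k.
Qed.

(** This is [dist_set_tent] in the coordinate [cumul A]. As [cumul A] need not be injective, the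
    kink is the supremum of the points of the interval at which [cumul A] has not passed the
    peak. *)
Lemma zigzag_kink A K a b : measurable A ->
  (forall k, K k -> k <= a \/ b <= k) ->
  (exists2 k, K k & k <= a) -> (exists2 k, K k & b <= k) ->
  exists c, forall y z, a < y -> y <= z -> z < b -> z < c \/ c < y ->
    `|zigzag A K z - zigzag A K y| = mass A y z.
Proof.
move=> mA Kab [k1 Kk1 k1a] [k2 Kk2 bk2].
have [|||c H] := @dist_set_tent _ (cumul A @` K) (cumul A a) (cumul A b).
- move=> _ [k Kk <-]; case: (Kab _ Kk) => ?; [left|right]; exact: cumul_le.
- by exists (cumul A k1); [exists k1|exact: cumul_le].
- by exists (cumul A k2); [exists k2|exact: cumul_le].
pose T := [set y | a < y < b /\ cumul A y <= c].
have [[y0 Ty0]|T0] := pselect (T !=set0); last first.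
  (* The whole interval is past the peak, so any kink would do. *)
  exists a => y z ay yz zb _.
  have yc : c < cumul A y.
    rewrite ltNge; apply/negP => yc; apply: T0; exists y; split => //.
    by rewrite ay (le_lt_trans yz zb).
  have [|||_] := H (cumul A y) (cumul A z); try by apply: cumul_le => //; lra.
  by move=> /(_ (ltW yc)) h; rewrite distrC h -cumulB// ger0_norm// subr_ge0 cumul_le.
have Tb : has_ubound T by exists b => y [/andP[_ /ltW]].
exists (sup T) => y z ay yz zb.
have [|||H1 H2] := H (cumul A y) (cumul A z); try by apply: cumul_le => //; lra.
case=> [zT|Ty].
- have zT' : 0 < sup T - z by rewrite subr_gt0.
  have [t [tab tc] zt] := sup_adherent zT' (conj (ex_intro _ y0 Ty0) Tb).
  rewrite subKr in zt.
  have zc : cumul A z <= c by apply: le_trans tc; apply: cumul_le => //; lra.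
  by rewrite (H1 zc) -cumulB// ger0_norm// subr_ge0 cumul_le.
- have yc : c <= cumul A y.
    rewrite leNgt; apply/negP => yc; move: Ty; rewrite ltNge => /negP; apply.
    apply: ub_le_sup => //; split; last exact: ltW.
    by rewrite ay (le_lt_trans yz zb).
  by rewrite distrC (H2 yc) -cumulB// ger0_norm// subr_ge0 cumul_le.
Qed.

End Zigzag.

(** * Choice of a scale that avoids three points *)

Section Scales.
Context {R : realType}.

(* Each of the three points spoils at most one of the four scales
   [h ^+ i * l], [1 <= i <= 4]. *)
Lemma good_scale (h l x p q s : R) : 0 < h -> h <= 2^-1 -> 0 < l ->
  exists r, [/\ h ^+ 4 * l <= r, r < l &
    forall t, t \in [:: p; q; s] -> `|t - x| < 2 * h * r \/ r < `|t - x|].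
Proof.
move=> h0 h1 l0.
pose bad i t := (2 * h * (h ^+ i * l) <= `|t - x| <= h ^+ i * l).
have hp i : 0 < h ^+ i * l by rewrite mulr_gt0// exprn_gt0.
have hS i j : (i < j)%N -> h ^+ j * l <= h * (h ^+ i * l).
  move=> ij; rewrite mulrA -exprS ler_pM2r// ler_wiXn2l ?(ltW h0)//; lra.
(* The bad window of scale [i] starts at [2 * h] times that scale, whereas every later scale is at
   most [h] times it, so the windows are disjoint. *)
have badN i j t : (i < j)%N -> bad i t -> bad j t -> False.
  move=> ij /andP[+ _] /andP[_]; have := hS _ _ ij.
  have : 0 < h * (h ^+ i * l) by rewrite mulr_gt0. lra.
suff [i /andP[i1 i4] Hi] : exists2 i, (0 < i <= 4)%N & ~~ [|| bad i p, bad i q | bad i s].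
  exists (h ^+ i * l); split.
  - by rewrite ler_pM2r// ler_wiXn2l ?(ltW h0)//; lra.
  - apply: le_lt_trans (hS 0%N i i1) _; rewrite expr0 mul1r.
    by rewrite -[ltRHS]mul1r ltr_pM2r//; lra.
  move=> t; rewrite !inE => tT; suff : ~~ bad i t.
    by rewrite negb_and -!ltNge => /orP.
  by move: Hi; rewrite !negb_or => /and3P[? ? ?]; case/or3P: tT => /eqP ->.
apply: contrapT => H.
have B i : (0 < i <= 4)%N -> [|| bad i p, bad i q | bad i s].
  by move=> i4; apply/negPn/negP => Hi; apply: H; exists i.
have := B 1%N isT; have := B 2%N isT; have := B 3%N isT; have := B 4%N isT.
do 4 (case/or3P => ?); match goal with
  H1 : is_true (bad ?i ?t), H2 : is_true (bad ?j ?t) |- _ =>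
    exact: (badN i j t isT H1 H2) end.
Qed.

End Scales.

(** * Neighbourhoods made of grid cells *)

Section Cells.
Context {R : realType}.
Implicit Types (K Q : set R).

(* Interior of the union of the closed cells of the grid [K] that meet [Q]. *)
Definition cell_nbhs K Q : set R :=
  [set y | exists2 q, Q q & forall z, K z -> ~ (q < z < y) /\ ~ (y < z < q)]^°.

(** The interval []a, b[] lies in a single cell of [K], so the [q] that serves [y] serves every
    other point of it. *)
Lemma cell_nbhs_homog K Q a b : (forall k, K k -> k <= a \/ b <= k) ->
  forall y y', a < y < b -> a < y' < b -> cell_nbhs K Q y -> cell_nbhs K Q y'.
Proof.
move=> Kab y y' yab yab' Uy.
have [q Qq qK] := interior_subset Uy.
have : nbhs y' `]a, b[%classic by apply: near_in_itvoo; rewrite in_itv.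
apply: filterS => w /=; rewrite in_itv/= => wab; exists q => // z Kz.
have [H1 H2] := qK z Kz; have := Kab z Kz.
split => /andP[zq zw].
- apply: H1; apply/andP; split => //; rewrite ltNge; apply/negP => yz.
  by case: (Kab z Kz); lra.
- apply: H2; apply/andP; split => //; rewrite ltNge; apply/negP => yz.
  by case: (Kab z Kz); lra.
Qed.

(** The point [q] may belong to [K]: then both cells that end at [q] meet [Q], and [q] is still
    interior to their union. *)
Lemma cell_nbhs_center K Q q r : 0 < r -> Q q ->
  (forall k k', K k -> K k' -> `|q - k| < r -> `|q - k'| < r -> k = k') ->
  cell_nbhs K Q q.
Proof.
move=> r0 Qq Kr.
have [d d0 dK] : exists2 d, 0 < d & forall k, K k -> `|q - k| < d -> k = q.
  have [[p [Kp pr pq]]|H] := pselect (exists p, [/\ K p, `|q - p| < r & p != q]).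
    exists `|q - p|; first by rewrite normr_gt0 subr_eq0 eq_sym.
    move=> k Kk kp; have kr := lt_trans kp pr.
    by move: kp; rewrite (Kr _ _ Kk Kp kr pr) ltxx.
  exists r => // k Kk kr; apply/eqP; apply/negPn/negP => kq.
  by apply: H; exists k.
apply/nbhs_ballP; exists d => //= y qy; exists q => // z Kz.
move: qy; rewrite /ball/= ltr_norml => /andP[qy1 qy2].
by split => /andP[z1 z2]; move: (dK z Kz); rewrite ltr_norml => H;
  have : z = q by [apply: H; apply/andP; split; lra]; lra.
Qed.

(** A point [q] beyond the neighbouring [k] or [k'] would be separated from [y] by it. *)
Lemma cell_nbhs_close K Q y r : (exists k, [/\ K k, y < k & k <= y + r]) ->
  (exists k, [/\ K k, k < y & y <= k + r]) -> cell_nbhs K Q y ->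
  exists2 q, Q q & `|q - y| <= r.
Proof.
move=> [k [Kk yk kr]] [k' [Kk' yk' kr']] /interior_subset[q Qq qK].
exists q => //; rewrite ler_norml; apply/andP; split; rewrite leNgt; apply/negP => qy.
- by case: (qK _ Kk') => + _; apply; apply/andP; split; lra.
- by case: (qK _ Kk) => _; apply; apply/andP; split; lra.
Qed.

Lemma measurable_cell_nbhs K Q : measurable (cell_nbhs K Q : set (measurableTypeR R)).
Proof. by apply: open_measurable; exact: open_interior. Qed.

End Cells.

(** * Small measure of [E] near a closed set disjoint from it *)

Section Smallness.
Context {R : realType}.
Local Notation mu := (@lebesgue_measure R).
Implicit Types (E A : set (measurableTypeR R)).

Lemma measure_bigcup_le (A_ : nat -> set (measurableTypeR R)) (e : R) : 0 <= e ->
  (forall k, measurable (A_ k)) ->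
  (forall k, mu (A_ k) <= (e / 2 ^+ k.+1)%:E)%E ->
  (mu (\bigcup_k A_ k) <= e%:E)%E.
Proof.
move=> e0 mA Ae.
apply: (@le_trans _ _ (\big[+%E/0%E]_(0 <= k <oo) mu (A_ k))%E).
  by apply: measure_sigma_subadditive => //; exact: bigcupT_measurable.
apply: le_trans (_ : _ <= \sum_(0 <= k <oo) (0 + (e / (2 ^ k.+1)%:R)%:E))%E _.
  by apply: lee_nneseries => // k _; rewrite add0e natrX.
apply: le_trans (epsilon_trick _ _ _) _ => //.
by rewrite eseries0// add0e.
Qed.

(** By [depth_bound] the condition on [depth F0] confines [y] to a bounded set, so the measures are
    finite. The neighbourhoods of the closed set [F] shrink to [F], which misses [E], and continuity
    from above applies. *)
Lemma small_neighborhood E (F F0 : set R) (l : nat) (e : R) :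
  measurable E -> closed F -> (forall x, E x -> ~ F x) -> 0 < e ->
  exists n, forall A, measurable A ->
    (forall y, A y -> [/\ E y, 2 ^- l.+1 < depth F0 y
       & exists2 q, F q & `|q - y| < 2 ^- n]) ->
    (mu A <= e%:E)%E.
Proof.
move=> mE cF EF e0.
pose V n : set R := \bigcup_(q in F) ball q (2 ^- n).
pose W : set R := depth F0 @^-1` [set t | 2 ^- l.+1 < t].
have mV n : measurable (V n : set (measurableTypeR R)).
  by apply: open_measurable; apply: bigcup_open => q _; exact: ball_open.
have mW : measurable (W : set (measurableTypeR R)).
  apply: open_measurable; apply: open_comp; last exact: open_gt.
  by move=> x _; exact: continuous_depth.
pose B n : set (measurableTypeR R) := E `&` W `&` V n.
have mB n : measurable (B n) by apply: measurableI => //; exact: measurableI.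
have B0 : \bigcap_n B n = set0.
  apply/seteqP; split => // y By.
  have [[Ey _] _] := By 0%N I.
  apply: (EF _ Ey); apply: cF => D /nbhs_ballP[d /= d0 dD].
  have [n nd] := exp2V_small d0.
  have [_ [q Fq qy]] := By n I; exists q; split => //; apply: dD.
  by apply: ball_sym; exact: (le_ball (ltW nd) qy).
have fin : (mu (B 0%N) < +oo)%E.
  pose m : R := 2 ^+ l.+1.
  apply: (@le_lt_trans _ _ (mu (`]-m, m[%classic : set (measurableTypeR R)))).
    apply: le_measure; [by apply: mem_set; exact: mB|by apply: mem_set|].
    move=> y [[_ Wy] _]; rewrite /= in_itv/= -ltr_norml.
    have := depth_bound F0 y; have m0 : 0 < m by rewrite exprn_gt0.
    move: Wy; rewrite /W/= -/m => Wy H.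
    have : m^-1 * (1 + `|y|) < 1.
      by apply: lt_le_trans H; rewrite ltr_pM2r// ltr_pwDl.
    by rewrite mulrC ltr_pdivrMr// mul1r; lra.
  by rewrite lebesgue_measure_itv/=; case: ifP; rewrite ?ltry.
have cB : nonincreasing_seq B.
  move=> n m nm; apply/subsetPset => y [EWy [q Fq qy]]; split => //.
  by exists q => //; exact: (le_ball (ler_exp2V nm) qy).
have := nonincreasing_cvg_mu fin mB _ cB.
rewrite B0 measure0 => /(_ measurable0).
have : nbhs (0 : \bar R)%E [set t | (t < e%:E)%E].
  by apply: open_nbhs_nbhs; split; [exact: open_ereal_lt_ereal|rewrite /= lte_fin].
move=> He /(_ _ He)[n _ /(_ n (leqnn n))/= Hn].
exists n => A mA HA; apply: ltW; apply: le_lt_trans Hn.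
apply: le_measure; [by apply: mem_set|by apply: mem_set; exact: mB|].
move=> y Ay; have [Ey ey [q Fq qy]] := HA y Ay.
by split; [split|exists q].
Qed.

End Smallness.

(** * Parameters of the construction, the layers and the waves *)

Section Construction.
Context {R : realType}.
Context (E : set (measurableTypeR R)) (F : nat -> set R) (delta : nat -> R).
Context (mE : measurable E).
Context (cF : forall n, closed (F n)).
Context (F_mono : forall n, F n `<=` F n.+1).
Context (E_F : forall x, E x <-> forall n, ~ F n x).
Context (delta_gt0 : forall n, 0 < delta n).
Context (delta_mono : forall n m, (n <= m)%N -> delta m <= delta n).
Local Notation mu := (@lebesgue_measure R).
Implicit Types (x y z : R) (n m i l : nat) (N : nat -> nat).

Definition tolerance n : R := 2 ^- n.+3.

(** By [grid_sep], a window of this radius around a point of depth above [2 ^- i.+1] has at most one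
    grid point; [delta n] keeps the scales in the range of the density condition. *)
Definition radius n N i : R := Num.min (delta n) (2 ^- (N i.+2).+1).

(* [tolerance n ^+ 4 * radius] is the smallest scale offered by [good_scale]. *)
Definition budget n N i : R := tolerance n ^+ 5 * radius n N i.

Definition small_at n l (eps : R) m : Prop :=
  forall A : set (measurableTypeR R), measurable A ->
    (forall y, A y -> [/\ E y, 2 ^- l.+1 < depth (F n) y
       & exists2 q, F n.+1 q & `|q - y| < 2 ^- m]) ->
    (mu A <= eps%:E)%E.

(** A choice function, so that [mesh] can be defined by recursion. The default [0] stands for the
    absence of a suitable exponent, which [finenessP] excludes for positive [eps]. *)
Definition fineness n l (eps : R) : nat := xget 0%N [set m | small_at n l eps m].

Lemma finenessP n l eps : 0 < eps -> small_at n l eps (fineness n l eps).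
Proof.
move=> eps0; rewrite /fineness; case: xgetP => [m -> //|H].
have EF x : E x -> ~ F n.+1 x by move=> /E_F.
have [m Hm] := small_neighborhood (F n) l mE (@cF n.+1) EF eps0.
by case: (H m).
Qed.

(* The summand [fineness] makes [cover m.+1] as small as the [budget]s of all
   earlier levels demand, divided by [2 ^+ m.+1] and [2 ^+ i.+1] so that these
   demands can be summed over the levels and over the shells
   [2 ^- i.+1 < depth (F m) <= 2 ^- i]. Taking partial sums makes [mesh n]
   monotone. *)
Fixpoint mesh n : nat -> nat :=
  if n isn't m.+1 then fun l => (\sum_(i < l.+1) (2 * i + 2))%N
  else fun l => (\sum_(i < l.+1) (mesh m i + (2 * i + 3 + m) +
    fineness m i (budget m (mesh m) i.+1 / 2 ^+ m.+1 / 2 ^+ i.+1)))%N.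

Lemma mesh_homo n : {homo mesh n : a b / (a <= b)%N}.
Proof.
move=> a b ab; case: n => [|n] /=.
  rewrite -!(big_mkord xpredT (fun i => 2 * i + 2)%N).
  by rewrite [leqRHS](@big_cat_nat _ _ _ a.+1)//= leq_addr.
pose h i := (mesh n i + (2 * i + 3 + n) +
    fineness n i (budget n (mesh n) i.+1 / 2 ^+ n.+1 / 2 ^+ i.+1))%N.
rewrite -!(big_mkord xpredT h).
by rewrite [leqRHS](@big_cat_nat _ _ _ a.+1)//= leq_addr.
Qed.

Lemma meshS n l : (mesh n l + (2 * l + 3 + n) +
   fineness n l (budget n (mesh n) l.+1 / 2 ^+ n.+1 / 2 ^+ l.+1) <= mesh n.+1 l)%N.
Proof. by rewrite /= big_ord_recr/= leq_addl. Qed.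

Lemma mesh_leS n l : (mesh n l <= mesh n.+1 l)%N.
Proof. by have := meshS n l; lia. Qed.

Lemma mesh_ge n l : (2 * l + 2 + n <= mesh n l)%N.
Proof.
case: n => [|n]; last by have := meshS n l; lia.
by rewrite /= big_ord_recr/=; lia.
Qed.

Lemma mesh_id n l : (l <= mesh n l)%N.
Proof. by have := mesh_ge n l; lia. Qed.

Lemma mesh_le n m l : (n <= m)%N -> (mesh n l <= mesh m l)%N.
Proof.
move=> /subnKC <-; elim: (m - n)%N => [|k IH]; first by rewrite addn0.
by rewrite addnS; exact: leq_trans (mesh_leS _ _).
Qed.

Lemma F_le n m : (n <= m)%N -> F n `<=` F m.
Proof.
move=> /subnKC <-; elim: (m - n)%N => [|k IH]; first by rewrite addn0.
by rewrite addnS; exact: subset_trans (@F_mono _).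
Qed.

Lemma depth_le n m x : (n <= m)%N -> depth (F m) x <= depth (F n) x.
Proof. by move=> nm; apply: depth_anti; exact: F_le. Qed.

Lemma tolerance_gt0 n : 0 < tolerance n. Proof. exact: exp2V_gt0. Qed.

Lemma radius_gt0 n N i : 0 < radius n N i.
Proof. by rewrite lt_min delta_gt0 exp2V_gt0. Qed.

Lemma budget_gt0 n N i : 0 < budget n N i.
Proof. by rewrite mulr_gt0 ?radius_gt0// exprn_gt0// tolerance_gt0. Qed.

Lemma budget_le n m i l : (n <= m)%N -> (i <= l)%N ->
  budget m (mesh m) l <= budget n (mesh n) i.
Proof.
move=> nm il; rewrite /budget; apply: ler_pM.
- by rewrite exprn_ge0// ltW// tolerance_gt0.
- by rewrite ltW// radius_gt0.
- by rewrite lerXn2r ?nnegrE ?(ltW (tolerance_gt0 _))//; apply: ler_exp2V; rewrite !ltnS.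
- rewrite /radius le_min !ge_min delta_mono//=; apply/orP; right.
  apply: ler_exp2V; rewrite ltnS; apply: leq_trans (mesh_le _ nm).
  by apply: mesh_homo; rewrite !ltnS.
Qed.

(* A point of [F n] already in [F n.-1] contributes at most itself, because the
   grid accumulates at it from both sides. *)
Definition cover n : set (measurableTypeR R) :=
  if n isn't m.+1 then setT else cell_nbhs (grid (depth (F m)) (mesh n)) (F n).

Definition later n : set (measurableTypeR R) :=
  \bigcup_(m in [set m | (n <= m)%N]) cover m.+1.

Definition layer n : set (measurableTypeR R) := (E `&` cover n) `\` later n.

Definition knots n : set R := grid (depth (F n)) (mesh n).

Definition wave n y : R := zigzag (layer n) (knots n) y.

Definition wave_sum y : R := limn (fun n => \sum_(j < n) wave j y).

(** * Measurability and disjointness of the layers *)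

Lemma measurable_cover n : measurable (cover n).
Proof. case: n => [|n]; [exact: measurableT|exact: measurable_cell_nbhs]. Qed.

Lemma measurable_later n : measurable (later n).
Proof. by apply: bigcup_measurable => m _; exact: measurable_cover. Qed.

Lemma measurable_layer n : measurable (layer n).
Proof.
apply: measurableD; last exact: measurable_later.
by apply: measurableI => //; exact: measurable_cover.
Qed.

Lemma measurable_E_later n : measurable (E `&` later n).
Proof. by apply: measurableI => //; exact: measurable_later. Qed.

Lemma cover_later n m : (n < m)%N -> cover m `<=` later n.
Proof. by case: m => // m; rewrite ltnS => nm x Ux; exists m. Qed.

Lemma trivIset_layer : trivIset setT layer.
Proof.
have H i j x : (i < j)%N -> layer i x -> layer j x -> False.
  by move=> ij [_ +] [[_ +] _] => + /(cover_later ij).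
apply/trivIsetP => i j _ _ ij; apply/seteqP; split => // x [Li Lj].
by move: ij; rewrite neq_ltn => /orP[]ij; [apply: H Li Lj|apply: H Lj Li].
Qed.

(** * Smallness of the later covers *)

Lemma depth_E_gt0 n x : E x -> 0 < depth (F n) x.
Proof. by move=> /E_F Ex; apply: depth_gt0. Qed.

(** Such a [y] has grid points within [2 ^- mesh n.+1 l] on either side, hence is that close to
    [F n.+1], and [mesh n.+1 l] exceeds the [fineness] that the bound requires. *)
Lemma small_cover_shell n l (A : set (measurableTypeR R)) : measurable A ->
  (forall y, A y -> [/\ E y, cover n.+1 y & 2 ^- l.+1 < depth (F n) y <= 2 ^- l]) ->
  (mu A <= (budget n (mesh n) l.+1 / 2 ^+ n.+1 / 2 ^+ l.+1)%:E)%E.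
Proof.
move=> mA HA; apply: (@finenessP n l) => //.
  by rewrite !divr_gt0 ?budget_gt0 ?exprn_gt0.
move=> y /HA[Ey Uy /andP[dy1 dy2]]; split => //.
have [q Fq qy] := cell_nbhs_close
  (grid_right (@depth_leD _ _) (@mesh_id _) dy2)
  (grid_left (@depth_leD _ _) (@mesh_id _) dy2) Uy.
exists q => //; apply: le_lt_trans qy _.
rewrite ltf_pV2 ?posrE ?exprn_gt0// ltr_eXn2l ?ltr1n//.
by have := meshS n l; lia.
Qed.

(** Each later cover is cut into shells of [depth (F m)], and the bounds of [small_cover_shell] are
    summed over [m] and [l]. *)
Lemma mass_later n i x a b : 2 ^- i.+1 < depth (F n) x <= 2 ^- i ->
  x - radius n (mesh n) i <= a -> b < x + radius n (mesh n) i ->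
  mass (E `&` later n) a b <= budget n (mesh n) i.
Proof.
move=> /andP[_ di] xa bx; rewrite -lee_fin massE; last exact: measurable_E_later.
have b0 := ltW (budget_gt0 n (mesh n) i).
have mi : measurable (`]a, b]%classic : set (measurableTypeR R)) by [].
pose A m := if (n <= m)%N then E `&` cover m.+1 `&` `]a, b] else set0.
have mA m : measurable (A m).
  rewrite /A; case: ifP => // _; apply: measurableI => //; apply: measurableI => //.
  exact: measurable_cover.
have -> : E `&` later n `&` `]a, b] = \bigcup_m A m.
  apply/seteqP; split => y /=.
    by move=> [[Ey [m /= nm Um]] yab]; exists m => //; rewrite /A nm.
  move=> [m _]; rewrite /A; case: ifP => // nm [[Ey Um] yab].
  by split => //; split => //; exists m.
apply: measure_bigcup_le => // m.
have [nm|nm] := leqP n m; last first.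
  by rewrite /A leqNgt nm /= measure0 lee_fin divr_ge0// exprn_ge0.
pose B l := A m `&` (depth (F m) @^-1` `]2 ^- l.+1, 2 ^- l]).
have mB l : measurable (B l).
  apply: measurableI => //; rewrite -[_ @^-1` _]setTI.
  apply: continuous_measurable_fun => //; exact: continuous_depth.
have AB : A m = \bigcup_l B l.
  apply/seteqP; split => y; last by case=> l _ [].
  move=> Ay; have Ey : E y by move: Ay; rewrite /A nm => -[[]].
  have [l Hl] := exp2V_shell (depth_E_gt0 m Ey) (depth_le1 _ _).
  by exists l => //; split => //=; rewrite in_itv.
rewrite AB; apply: measure_bigcup_le => //; first by rewrite divr_ge0// exprn_ge0.
move=> l; have [il|li] := leqP i l.+1.
  apply: le_trans (_ : _ <= (budget m (mesh m) l.+1 / 2 ^+ m.+1 / 2 ^+ l.+1)%:E)%E _.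
    apply: small_cover_shell => // y [Ay]; rewrite /= in_itv/= => dl.
    by move: Ay; rewrite /A nm => -[[]].
  rewrite lee_fin !ler_pM2r ?invr_gt0 ?exprn_gt0//.
  exact: budget_le.
(* For [l.+1 < i] the shell misses the window: there [depth (F m)] is at most [depth (F n)], which
   exceeds [2 ^- i] by no more than the distance to [x]. *)
suff -> : B l = set0 by rewrite measure0 lee_fin !divr_ge0// exprn_ge0.
apply/seteqP; split => // y [Ay]; rewrite /= in_itv/= => /andP[dl _].
have /andP[ay yb] : a < y <= b.
  by move: Ay; rewrite /A nm => -[_]; rewrite /= in_itv.
have yx : `|y - x| <= 2 ^- i.+3.
  have H : radius n (mesh n) i <= 2 ^- i.+3.
    rewrite ge_min; apply/orP; right; apply: ler_exp2V.
    by have := mesh_ge n i.+2; lia.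
  by rewrite ler_norml; apply/andP; split; lra.
have := depth_le y nm; have := depth_leD (F n) y x.
have := @ler_exp2V R _ _ li.
have := @exp2VS R i; have := @exp2VS R i.+1; have := @exp2VS R i.+2; have := @exp2V_gt0 R i.
have := @exp2VS R l.+1; lra.
Qed.

(** * Bounds on the waves and convergence of their sum *)

Lemma knots_right n i y : depth (F n) y <= 2 ^- i ->
  exists k, [/\ knots n k, y < k & k <= y + 2 ^- mesh n i].
Proof. exact: (grid_right (@depth_leD _ _) (@mesh_id _)). Qed.

Lemma knots_left n i y : depth (F n) y <= 2 ^- i ->
  exists k, [/\ knots n k, k < y & y <= k + 2 ^- mesh n i].
Proof. exact: (grid_left (@depth_leD _ _) (@mesh_id _)). Qed.

Let depth_le_exp0 n y : depth (F n) y <= 2 ^- 0.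
Proof. by rewrite expr0 invr1 depth_le1. Qed.

Lemma knots_nonempty n : knots n !=set0.
Proof. by have [k []] := knots_right (depth_le_exp0 n 0); exists k. Qed.

Lemma wave_ge0 n y : 0 <= wave n y.
Proof. exact: zigzag_ge0 (knots_nonempty n). Qed.

(** A knot, where the wave vanishes, lies within [2 ^- mesh n i]. The [2 * i] in the exponent makes
    the bound quadratic in [2 ^- i], and the [n] makes the waves summable. *)
Lemma wave_bound n i y : depth (F n) y <= 2 ^- i -> wave n y <= 2 ^- (2 * i + 2 + n).
Proof.
move=> /knots_right[k [Kk yk ky]].
apply: le_trans (zigzag_le _ (measurable_layer n) Kk) _.
rewrite distrC gtr0_norm ?subr_gt0//.
by apply: le_trans (ler_exp2V (mesh_ge n i)); rewrite lerBlDl.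
Qed.

Lemma wave_sum_cvg y : (fun n => \sum_(j < n) wave j y) @ \oo --> wave_sum y.
Proof.
apply: nondecreasing_is_cvgn.
  apply/nondecreasing_seqP => n; rewrite big_ord_recr/= lerDl; exact: wave_ge0.
exists 1 => _ [n _ <-].
suff : \sum_(j < n) wave j y <= 1 - 2 ^- n by have := @exp2V_gt0 R n; lra.
elim: n => [|n IH]; first by rewrite big_ord0 expr0 invr1 subrr.
rewrite big_ord_recr/=; have := wave_bound (depth_le_exp0 n y).
have : 2 ^- (2 * 0 + 2 + n) <= 2 ^- n.+1 :> R by apply: ler_exp2V; lia.
have := @exp2VS R n; lra.
Qed.

Lemma wave_sum_close a b c (e : R) n0 :
  (forall n, (n0 <= n)%N -> `|\sum_(j < n) (wave j b - wave j a) - c| <= e) ->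
  `|wave_sum b - wave_sum a - c| <= e.
Proof.
move=> H.
have C : (fun n => `|\sum_(j < n) (wave j b - wave j a) - c|) @ \oo -->
    `|wave_sum b - wave_sum a - c|.
  under eq_fun do rewrite sumrB.
  apply: cvg_norm; apply: cvgB; last exact: cvg_cst.
  by apply: cvgB; exact: wave_sum_cvg.
rewrite -(cvg_lim _ C)//; apply: limr_le; first by apply: cvgP C.
by exists n0 => // n /= /H.
Qed.

(** Each wave varies by at most the mass of its layer, and the layers are disjoint. *)
Lemma sum_wave_le a b n (P : pred nat) (B : set (measurableTypeR R)) : a <= b ->
  measurable B -> (forall j x, P j -> a < x <= b -> layer j x -> B x) ->
  `|\sum_(j < n | P j) (wave j b - wave j a)| <= mass B a b.
Proof.
move=> ab mB HB; apply: le_trans (ler_norm_sum _ _ _) _.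
apply: (le_trans _ (sum_mass_le n measurable_layer mB trivIset_layer HB)).
apply: ler_sum => j _; apply: zigzag_lip => //.
  exact: measurable_layer.
exact: knots_nonempty.
Qed.

(** * Increments of the sum: upper bound, steepness on [E], flatness off [E] *)

Lemma wave_sum_mass_le a b : a <= b -> `|wave_sum b - wave_sum a| <= mass E a b.
Proof.
move=> ab; rewrite -[wave_sum b - wave_sum a]subr0; apply: (wave_sum_close (n0 := 0%N)) => n _.
by rewrite subr0; apply: (@sum_wave_le a b n xpredT E) => // j x _ _ [[]].
Qed.

Lemma wave_sum_lip x y : `|wave_sum x - wave_sum y| <= `|x - y|.
Proof.
wlog xy : x y / x <= y.
  move=> H; case: (leP x y) => [|/ltW] xy; first exact: H.
  by rewrite distrC (distrC x); exact: H.
rewrite distrC (distrC x); apply: le_trans (wave_sum_mass_le xy) _.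
by rewrite ger0_norm ?subr_ge0// mass_le_length.
Qed.

(** Without knots of level [n] in []a, b[], each cover of index at most [n] contains all or nothing
    of it. If [p] is the last one that contains it, then there [layer p] is [E] up to [later n], and
    [wave p] dominates. One [xi] pays for the other waves, the second for the part of [E] outside
    [layer p]. *)
Lemma wave_sum_kink n a b (xi : R) :
  (forall k, knots n k -> k <= a \/ b <= k) ->
  (forall y z, a < y -> y <= z -> z < b -> mass (E `&` later n) y z <= xi) ->
  exists c, forall y z, a < y -> y <= z -> z < b -> z < c \/ c < y ->
    mass E y z - 2 * xi <= `|wave_sum z - wave_sum y|.
Proof.
move=> Kab Wxi; have [ab|ba] := ltP a b; last first.
  by exists a => y z ay yz zb; move: (lt_le_trans (lt_le_trans ay yz) (ltW zb)); lra.
pose w := (a + b) / 2; have wab : a < w < b by rewrite /w; apply/andP; split; lra.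
have Khomog j y : (j <= n)%N -> a < y < b -> cover j w <-> cover j y.
  case: j => // j jn yab.
  (* The grid behind [cover j.+1] is a part of [knots n]. *)
  have Kj k : grid (depth (F j)) (mesh j.+1) k -> k <= a \/ b <= k.
    move=> Kk; apply: Kab; apply: grid_sub Kk => [z|i].
      by apply: depth_le; exact: ltnW.
    exact: mesh_le.
  by split; exact: (cell_nbhs_homog Kj).
(* The search for the last cover starts from [cover 0], the whole line. *)
have ex : exists j, (j <= n)%N && `[< cover j w >].
  by exists 0%N; apply/andP; split => //; apply/asboolP.
have ub j : (j <= n)%N && `[< cover j w >] -> (j <= n)%N by case/andP.
case: (ex_maxnP ex ub) => p /andP[pn /asboolP Upw] pmax.
have Kp k : knots p k -> k <= a \/ b <= k.
  move=> Kk; apply: Kab; apply: grid_sub Kk => [z|i]; first exact: depth_le.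
  exact: mesh_le.
have ka : exists2 k, knots p k & k <= a.
  by have [k [Kk ka _]] := knots_left (depth_le_exp0 p a); exists k => //; exact: ltW.
have kb : exists2 k, knots p k & b <= k.
  by have [k [Kk kb _]] := knots_right (depth_le_exp0 p b); exists k => //; exact: ltW.
have [c Hc] := zigzag_kink (measurable_layer p) Kp ka kb.
exists c => y z ay yz zb yzc.
have in_ab t : y < t <= z -> a < t < b by move=> /andP[? ?]; apply/andP; split; lra.
have close : `|wave_sum z - wave_sum y - (wave p z - wave p y)| <= xi.
  apply: (wave_sum_close (n0 := p.+1)) => N pN.
  rewrite (bigD1 (Ordinal pN))//= [_ + _ - _]addrC addrA addNr add0r.
  apply: le_trans (Wxi _ _ ay yz zb).
  apply: (@sum_wave_le y z N (fun j => j != p)) => //; first exact: measurable_E_later.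
  move=> j t jp yt [[Et Ujt] Wt]; split => //.
  have [jn|nj] := leqP j n; last exact: cover_later Ujt.
  have /(Khomog _ _ jn) Ujw := in_ab _ yt.
  have jlep : (j <= p)%N by apply: pmax; rewrite jn; apply/asboolP/Ujw.
  exfalso; apply: Wt; apply: (@cover_later j p); first by rewrite ltn_neqAle jp.
  by apply/(Khomog _ _ pn (in_ab _ yt)).
have massle : mass E y z <= mass (layer p) y z + mass (E `&` later n) y z.
  apply: mass_leD => //; [exact: measurable_layer|exact: measurable_E_later|].
  move=> t yt Et; have [Wt|Wt] := pselect (later n t); first by right.
  left; split; first by split => //; apply/(Khomog _ _ pn (in_ab _ yt)).
  move=> [m /= pm Um]; apply: Wt; have [mn|nm] := ltnP m n; last by exists m.
  have : (m.+1 <= p)%N.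
    by apply: pmax; rewrite mn; apply/asboolP/(Khomog _ _ mn (in_ab _ yt)).
  by rewrite ltnNge pm.
have := Hc y z ay yz zb yzc; rewrite -/(wave p z) -/(wave p y) => Hw.
have := Wxi _ _ ay yz zb.
have := ler_distD (wave_sum z - wave_sum y) (wave p z - wave p y) 0.
rewrite !subr0 Hw (distrC (wave p z - wave p y)); lra.
Qed.

(** The window around [x] has at most one knot [p], and on each side of [p] the sum has one kink up
    to the budget. The scale [r] is such that [p] and both kinks are closer to [x] than [2 * h * r]
    or farther than [r]. *)
Lemma wave_sum_steep n x : E x -> exists r, [/\ 0 < r, r <= delta n,
  mass E x (x + r) - 6 * tolerance n * r <= `|wave_sum (x + r) - wave_sum x| &
  mass E (x - r) x - 6 * tolerance n * r <= `|wave_sum (x - r) - wave_sum x|].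
Proof.
move=> Ex; have [i di] := exp2V_shell (depth_E_gt0 n Ex) (depth_le1 _ _).
set l := radius n (mesh n) i; have l0 : 0 < l := radius_gt0 _ _ _.
set h := tolerance n; have h0 : 0 < h := tolerance_gt0 n.
have h2 : h <= 2^-1 := @ler_exp2V R 1 n.+3 isT.
have sep k k' : knots n k -> knots n k' -> `|x - k| < l -> `|x - k'| < l -> k = k'.
  have /andP[di1 _] := di.
  apply: (grid_sep (@depth_leD _ (F n)) (@mesh_id n) (@mesh_homo n) di1).
  by rewrite ge_min lexx orbT.
have [p Hp] : exists p, forall k, knots n k -> x - l < k -> k < x + l -> k = p.
  have [[p [Kp px]]|H] := pselect (exists p, knots n p /\ `|x - p| < l).
    exists p => k Kk kx xk; apply: sep => //.
    by rewrite ltr_norml; apply/andP; split; lra.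
  (* Without a knot in the window any [p] would do. *)
  exists x => k Kk kx xk; exfalso; apply: H; exists k; split => //.
  by rewrite ltr_norml; apply/andP; split; lra.
have small y z : x - l < y -> z < x + l ->
    mass (E `&` later n) y z <= budget n (mesh n) i.
  by move=> xy zx; apply: (mass_later di) => //; exact: ltW.
have [c1 H1] : exists c, forall y z, x - l < y -> y <= z -> z < Num.min p (x + l) ->
    z < c \/ c < y -> mass E y z - 2 * budget n (mesh n) i <= `|wave_sum z - wave_sum y|.
  apply: (@wave_sum_kink n).
    move=> k Kk; have [kl|kl] := leP k (x - l); first by left.
    right; rewrite ge_min; have [kr|kr] := leP (x + l) k; first by rewrite orbT.
    by rewrite (Hp k Kk kl kr) lexx.
  by move=> y z xy _; rewrite lt_min => /andP[_]; exact: small.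
have [c2 H2] : exists c, forall y z, Num.max p (x - l) < y -> y <= z -> z < x + l ->
    z < c \/ c < y -> mass E y z - 2 * budget n (mesh n) i <= `|wave_sum z - wave_sum y|.
  apply: (@wave_sum_kink n).
    move=> k Kk; have [kl|kl] := leP (x + l) k; first by right.
    left; rewrite le_max; have [kr|kr] := leP k (x - l); first by rewrite orbT.
    by rewrite (Hp k Kk kr kl) lexx.
  by move=> y z; rewrite gt_max => /andP[_ xy] _; exact: small.
have [r [rl rl' good]] := good_scale x p c1 c2 h0 h2 l0.
have r0 : 0 < r by apply: lt_le_trans rl; rewrite mulr_gt0// exprn_gt0.
have bud : budget n (mesh n) i <= h * r.
  by rewrite /budget -/l -/h exprS -mulrA ler_pM2l.
have hr : 2 * h * r <= r by rewrite -[leRHS]mul1r ler_pM2r//; lra.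
have hr0 : 0 < h * r by rewrite mulr_gt0.
have G t : t \in [:: p; c1; c2] ->
    [\/ `|t - x| < 2 * h * r, t < x - r | x + r < t].
  move=> /good[H|H]; first by constructor 1.
  by move: H; rewrite ltr_normr => /orP[?|?]; [constructor 3|constructor 2]; lra.
(* The pieces at distance between [2 * h * r] and [r] contain none of the three points, so each lies
   on one side of the knot and of the relevant kink. *)
have side y z : (y = x + 2 * h * r /\ z = x + r) \/ (y = x - r /\ z = x - 2 * h * r) ->
    mass E y z - 2 * budget n (mesh n) i <= `|wave_sum z - wave_sum y|.
  move=> yz.
  have yz' : [/\ x - l < y, y <= z & z < x + l].
    by clear -yz hr hr0 rl' r0 l0; case: yz => -[-> ->]; split; lra.
  have out t : t \in [:: p; c1; c2] -> z < t \/ t < y.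
    move=> /G; rewrite ltr_norml.
    clear -yz hr hr0 r0; case: yz => -[-> ->] [/andP[? ?]|?|?];
      by (left; lra) || (right; lra).
  case: yz' => ly lyz zl; have [zp|py] := out p (mem_head _ _).
  - by apply: H1; rewrite ?lt_min ?zp//; apply: out; rewrite !inE eqxx orbT.
  - by apply: H2; rewrite ?gt_max ?py//; apply: out; rewrite !inE eqxx !orbT.
have rd : r <= delta n by apply: ltW; apply: lt_le_trans rl' _; rewrite ge_min lexx.
(* The omitted inner piece costs [2 * h * r] in mass and as much in increment, and the two budgets
   cost [2 * h * r] together: hence the [6]. *)
have tri (m m' B u v w : R) : m <= 2 * h * r + m' -> m' - 2 * B <= `|u - v| ->
    `|v - w| <= 2 * h * r -> B <= h * r -> m - 6 * h * r <= `|u - w|.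
  by have := ler_distD w u v; rewrite (distrC w); clear; lra.
exists r; split => //.
- have S := side _ _ (or_introl (conj erefl erefl)).
  have M : mass E x (x + r) <= 2 * h * r + mass E (x + 2 * h * r) (x + r).
    rewrite (mass_split mE (_ : x <= x + 2 * h * r)); [|lra..].
    rewrite lerD2r; apply: le_trans (mass_le_length mE _) _; lra.
  have T : `|wave_sum (x + 2 * h * r) - wave_sum x| <= 2 * h * r.
    apply: le_trans (wave_sum_lip _ _) _.
    by rewrite (_ : x + 2 * h * r - x = 2 * h * r) ?gtr0_norm; [|lra|ring].
  exact: (tri _ _ _ _ _ _ M S T bud).
- have S := side _ _ (or_intror (conj erefl erefl)).
  have M : mass E (x - r) x <= 2 * h * r + mass E (x - r) (x - 2 * h * r).
    rewrite (@mass_split _ _ (x - r) (x - 2 * h * r) x mE); [|lra..].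
    rewrite addrC lerD2r; apply: le_trans (mass_le_length mE _) _; lra.
  have T : `|wave_sum (x - 2 * h * r) - wave_sum x| <= 2 * h * r.
    apply: le_trans (wave_sum_lip _ _) _.
    by rewrite (_ : x - 2 * h * r - x = - (2 * h * r)) ?normrN ?gtr0_norm; [|lra|ring].
  rewrite distrC in S; exact: (tri _ _ _ _ _ _ M S T bud).
Qed.

(** Let [n] be the first index with [F n x]. A ball around [x] lies in [cover n], so the earlier
    layers are absent from it. The waves from [n] on vanish at [x] and, at [y], are at most [2 ^- j]
    times the squared distance; these weights sum to less than [2]. *)
Lemma wave_sum_flat x : ~ E x -> exists2 r, 0 < r &
  forall y, `|x - y| < r -> `|wave_sum y - wave_sum x| <= 2 * `|x - y| ^+ 2.
Proof.
move=> nEx.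
have ex : exists n, `[< F n x >].
  apply: contrapT => H; apply: nEx; apply/E_F => n Fx; apply: H.
  by exists n; apply/asboolP.
case: (ex_minnP ex) => n /asboolP Fx nmin.
have Fm m : (n <= m)%N -> F m x by move=> nm; exact: F_le Fx.
have [r [r0 r1 rU]] : exists r, [/\ 0 < r, r <= 1 & ball x r `<=` cover n].
  have : nbhs x (cover n).
    case: n Fx nmin {Fm} => [|n] Fx nmin; first exact: filterT.
    apply: open_nbhs_nbhs; split; first exact: open_interior.
    (* By minimality [x] is outside the preceding closed set, so the grid is locally finite at
       [x]. *)
    have d0 : 0 < depth (F n) x.
      apply: depth_gt0 => // Fnx; have := nmin n; rewrite ltnn => H.
      by have := H (asboolT Fnx).
    have [i /andP[di _]] := exp2V_shell d0 (depth_le1 _ _).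
    apply: (@cell_nbhs_center _ _ _ _ (2 ^- (mesh n.+1 i.+2).+1)) => //.
    exact: (grid_sep (@depth_leD _ (F n)) (@mesh_id n.+1) (@mesh_homo n.+1) di).
  move=> /nbhs_ballP[r /= r0 rU]; exists (Num.min r 1); split.
  - by rewrite lt_min r0/=.
  - by rewrite ge_min lexx orbT.
  - by apply: subset_trans rU; apply: le_ball; rewrite ge_min lexx.
exists r => // y xy; have [->|yx] := eqVneq y x.
  by rewrite !subrr !normr0 expr0n mulr0.
have d0 : 0 < `|x - y| by rewrite normr_gt0 subr_eq0 eq_sym.
have [i /andP[di1 di2]] := exp2V_shell d0 (le_trans (ltW xy) r1).
(* Here [depth (F j) x] is zero, so [wave_bound] applies with every exponent [m]. *)
have wave0 j : (n <= j)%N -> wave j x = 0.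
  move=> nj; apply/eqP; rewrite eq_le wave_ge0 andbT; apply/ler_addgt0Pl => e e0.
  have [m me] := exp2V_small e0; rewrite addr0; apply: ltW; apply: le_lt_trans me.
  apply: le_trans (wave_bound (i := m) _) _.
    by rewrite (depth_in (Fm _ nj)) ltW// exp2V_gt0.
  by apply: ler_exp2V; lia.
have term j : `|wave j y - wave j x| <= 2 ^- j * `|x - y| ^+ 2.
  have rhs0 : 0 <= 2 ^- j * `|x - y| ^+ 2.
    by rewrite mulr_ge0 ?exprn_ge0// ltW// exp2V_gt0.
  have [nj|jn] := leqP n j.
    rewrite (wave0 _ nj) subr0 ger0_norm ?wave_ge0//.
    have dj : depth (F j) y <= 2 ^- i.
      by apply: le_trans di2; rewrite distrC; apply: depth_le_dist; exact: Fm.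
    apply: le_trans (wave_bound dj) _.
    have -> : 2 ^- (2 * i + 2 + j) = 2 ^- j * (2 ^- i.+1) ^+ 2 :> R.
      by rewrite -!exprVn -exprM -exprD; congr (_ ^+ _); lia.
    rewrite ler_pM2l ?exp2V_gt0//; apply: lerXn2r; rewrite ?nnegrE ?normr_ge0 ?(ltW di1)//.
  have L0 a b : a <= b -> x - r < a -> b < x + r -> mass (layer j) a b = 0.
    move=> ab xa bx; apply: mass_eq0; first exact: measurable_layer.
    move=> t /andP[at_ tb] [_]; apply; apply: (cover_later jn); apply: rU.
    by rewrite /ball/= ltr_norml; apply/andP; split; lra.
  suff -> : `|wave j y - wave j x| = 0 by [].
  move: xy; rewrite ltr_norml => /andP[xy1 xy2].
  apply/eqP; rewrite eq_le normr_ge0 andbT; have [xley|ylex] := leP x y.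
    rewrite -(L0 x y xley); [|lra..].
    by apply: zigzag_lip => //; [exact: measurable_layer|exact: knots_nonempty].
  rewrite distrC -(L0 y x (ltW ylex)); [|lra..].
  by apply: zigzag_lip; [exact: measurable_layer|exact: knots_nonempty|exact: ltW].
rewrite -[wave_sum y - wave_sum x]subr0; apply: (wave_sum_close (n0 := 0%N)) => N _.
rewrite subr0; apply: le_trans (ler_norm_sum _ _ _) _.
apply: le_trans (ler_sum _ (fun (j : 'I_N) _ => term j)) _.
rewrite -mulr_suml ler_wpM2r ?exprn_ge0//.
suff -> : \sum_(j < N) 2 ^- j = 2 - 2 * 2 ^- N :> R by have := @exp2V_gt0 R N; lra.
elim: N => [|N IH]; first by rewrite big_ord0 expr0 invr1; lra.
by rewrite big_ord_recr/= IH exp2VS; field.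
Qed.

End Construction.

(** * Criteria for bounds on [Lip] *)

Section LipBounds.
Context {R : realType}.
Implicit Types (f : R -> R) (x c : R).

Lemma inve_EFin_gt0 (r : R) : 0 < r -> (r%:E^-1)%E = (r^-1)%:E.
Proof. by move=> r0; rewrite inver gt_eqF. Qed.

Lemma Lip_le f x c :
  (exists2 d, 0 < d & forall y r, 0 < r -> r < d -> `|x - y| <= r ->
     `|f x - f y| <= c * r) ->
  (Lip f x <= c%:E)%E.
Proof.
move=> [d d0 H]; rewrite /Lip.
apply: (@le_trans _ _ (ereal_sup (oscillation_quotient f x @` `]0, d[))).
  apply: ereal_inf_lbound; exists `]0, d[%classic => //.
  near=> r; rewrite /= in_itv/=; apply/andP; split; near: r.
    exact: nbhs_right_gt.
  exact: nbhs_right_lt.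
apply: ge_ereal_sup => _ [r + <-]; rewrite /= in_itv/= => /andP[r0 rd].
rewrite /oscillation_quotient inve_EFin_gt0// lee_pdivrMr// -EFinM.
apply: ge_ereal_sup => _ [y /= xy <-]; rewrite lee_fin; exact: H.
Unshelve. all: by end_near. Qed.

Lemma Lip_ge f x c :
  (forall d, 0 < d -> exists r y, [/\ 0 < r, r < d, `|x - y| <= r &
     c * r <= `|f x - f y|]) ->
  (c%:E <= Lip f x)%E.
Proof.
move=> H; apply: le_ereal_inf_tmp => _ [V /nbhs_ballP[d /= d0 dV] <-].
have [r [y [r0 rd xy cr]]] := H d d0.
apply: (@le_trans _ _ (oscillation_quotient f x r)); last first.
  apply: ereal_sup_ubound; exists r => //; apply: dV => //.
  by rewrite /ball/= sub0r normrN gtr0_norm.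
rewrite /oscillation_quotient inve_EFin_gt0// lee_pdivlMr// -EFinM.
apply: (@le_trans _ _ (`|f x - f y|)%:E); first by rewrite lee_fin.
by apply: ereal_sup_ubound; exists y.
Qed.

Lemma Lip_ge0 f x : (0 <= Lip f x)%E.
Proof.
apply: Lip_ge => d d0; exists (d / 2), x.
by rewrite !subrr !normr0 mul0r; split => //; lra.
Qed.

End LipBounds.

(** * From one-sided densities and the constructed function to [Lip f] *)

Lemma density_mass_le {R : realType} (E : set (measurableTypeR R)) (gamma r : R) a b
    (i : interval R) : measurable E -> 0 < r -> ([set` i] `<=` `]a, b]) ->
  (gamma%:E <= lebesgue_measure ([set` i] `&` E) / r%:E)%E -> gamma * r <= mass E a b.
Proof.
move=> mE r0 iab; rewrite inve_EFin_gt0// lee_pdivlMr// -EFinM => H.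
rewrite -lee_fin massE//; apply: le_trans H _.
have mi : measurable ([set` i] : set (measurableTypeR R)) by exact: measurable_itv.
have mab : measurable (`]a, b]%classic : set (measurableTypeR R)) by [].
rewrite setIC; apply: le_measure; try (apply: mem_set; exact: measurableI).
by apply: setIS.
Qed.

Lemma steep_flat_function {R : realType} (E : set (measurableTypeR R))
    (F : nat -> set R) (delta : nat -> R) :
  measurable E -> (forall n, closed (F n)) -> (forall n, F n `<=` F n.+1) ->
  (forall x, E x <-> forall n, ~ F n x) -> (forall n, 0 < delta n) ->
  (forall n m, (n <= m)%N -> delta m <= delta n) ->
  exists f : R -> R, [/\ forall x y, `|f x - f y| <= `|x - y|,
    forall x, ~ E x -> exists2 r, 0 < r &
      forall y, `|x - y| < r -> `|f y - f x| <= 2 * `|x - y| ^+ 2 &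
    forall n x, E x -> exists r, [/\ 0 < r, r <= delta n,
      mass E x (x + r) - 6 * tolerance n * r <= `|f (x + r) - f x| &
      mass E (x - r) x - 6 * tolerance n * r <= `|f (x - r) - f x|]].
Proof.
move=> mE cF F_mono E_F delta_gt0 delta_le; exists (wave_sum E F delta); split.
- exact: wave_sum_lip.
- by move=> x; exact: wave_sum_flat.
- by move=> n x; exact: wave_sum_steep.
Qed.

Theorem theorem5p6 (R : realType) (E : set R)
    (hG : Gdelta E) (hU : uniform_density_type E) :
  is_Lip1 E.
Proof.
case: hU => _ [gamma_ [delta_ [[_ _ cvg_gamma] [[delta_gt0 delta_mono cvg_delta] EUDT]]]].
have mE : measurable (E : set (measurableTypeR R)) by exact: Gdelta_measurable.
case: hG => A oA EA.
pose F n : set R := \bigcup_(i in `I_n.+1) ~` A i.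
have cF n : closed (F n).
  by apply: closed_bigcup => [|i _]; [exact: finite_II|exact: open_closedC].
have F_mono n : F n `<=` F n.+1.
  by move=> x [i /= ni Ax]; exists i => //=; exact: leqW.
have E_F x : E x <-> forall n, ~ F n x.
  rewrite EA; split => [Ex n [i _]|Fx i _]; first by apply; exact: Ex.
  by apply: contrapT => Ax; apply: (Fx i); exists i => /=.
have delta_le n m : (n <= m)%N -> delta_ m <= delta_ n by exact: delta_mono.
have [f [f_lip f_flat f_steep]] :=
  steep_flat_function mE cF F_mono E_F delta_gt0 delta_le.
exists f; first exact: lipschitz1_continuous.
move=> x; apply/eqP; rewrite eq_le indicE.
have [/set_mem Ex|/negP Ex] := boolP (x \in E).
  apply/andP; split.
    apply: Lip_le; exists 1 => // y r r0 _ xy.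
    by rewrite mul1r; exact: le_trans (f_lip _ _) xy.
  apply/lee_subgt0Pr => e e0; rewrite -EFinB; apply: Lip_ge => d d0.
  have e2 : 0 < e / 2 by lra.
  have [n1 _ Hn1] := (cvgrPdist_lt _ _).1 cvg_gamma _ e2.
  have [n2 _ Hn2] := (cvgrPdist_lt _ _).1 cvg_delta _ d0.
  (* The error [e] is split evenly between [1 - gamma_ n] and [6 * tolerance n], whence [e / 12]. *)
  have [n3 Hn3] := @exp2V_small R (e / 12) (ltac:(lra)).
  have [n /= nk Dn] := EUDT _ Ex (maxn n1 (maxn n2 n3)) I.
  move: nk; rewrite !geq_max => /and3P[n1n n2n n3n].
  have gn : 1 - e / 2 < gamma_ n.
    by have := Hn1 n n1n; rewrite /= ltr_norml => /andP[_]; lra.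
  have dn : delta_ n < d.
    by have := Hn2 n n2n; rewrite /= sub0r normrN gtr0_norm.
  have tn : 6 * tolerance n <= e / 2.
    have : 2 ^- n.+3 <= 2 ^- n3 :> R by apply: ler_exp2V; lia.
    by rewrite /tolerance; lra.
  have [r [r0 rdn Sr Sl]] := f_steep n x Ex.
  have rd := le_lt_trans rdn dn.
  have cr (m D : R) : gamma_ n * r <= m -> m - 6 * tolerance n * r <= D ->
      (1 - e) * r <= D.
    move=> gm mD; apply: le_trans mD; apply: le_trans (lerB gm (lexx _)).
    by rewrite -mulrBl ler_pM2r//; lra.
  have : r \in `]0, delta_ n] by rewrite in_itv/= r0.
  (* The same [r] is good on both sides of [x], so the side on which [E] is dense may be chosen
     after the scale. *)
  move=> /Dn; rewrite le_max => /orP[dens|dens].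
  - exists r, (x - r); split=> //; first by rewrite subKr gtr0_norm.
    rewrite distrC; apply: cr Sl; apply: density_mass_le dens => //.
    by apply: subset_itvl; rewrite bnd_simp.
  - exists r, (x + r); split=> //; first by rewrite distrC addrAC subrr add0r gtr0_norm.
    rewrite distrC; apply: cr Sr; apply: density_mass_le dens => //.
    by apply: subset_itvl; rewrite bnd_simp.
have {}Ex : ~ E x by move=> /mem_set.
rewrite Lip_ge0 andbT; apply/lee_addgt0Pr => e e0; rewrite add0e.
have [r r0 Hr] := f_flat x Ex.
(* At scales [s] below [e / 2], twice the squared distance is at most [e * s]. *)
apply: Lip_le; exists (Num.min r (e / 2)); first by rewrite lt_min r0; lra.
move=> y s s0; rewrite lt_min => /andP[sr se] xy; rewrite distrC.
apply: le_trans (Hr _ (le_lt_trans xy sr)) _.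
rewrite expr2 mulrA; apply: ler_pM => //.
lra.
Qed.
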